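(* Let $\epsilon,\delta\in\{1,i\}$ with $\delta\neq\epsilon$ (so $\delta^2\epsilon^2=-1$), and let $\theta\in(0,\frac{\pi}{4})$. Let $M$ be a pseudo-Riemannian surface with coordinates $(x,y)$ and metric $dx^2-\epsilon^2dy^2$, and let $N$ be the pseudo-Riemannian surface with coordinates $(R,S)$ and metric $$h=dR^2-\delta^2\tanh^2R\,dS^2 .$$ Then the map $u=(R,S):M\to N$ given by $$R(x,y)=\operatorname{arcsinh}\left(\frac{\cos\theta\cdot y-\sin\theta\cdot x}{\cos^2\theta-\epsilon^2\sin^2\theta}\right),$$ $$S(x,y)=\cos\theta\cdot x+\sin\theta\cdot y+\frac{(1+\epsilon^2)\cos\theta\sin\theta}{\sin^2\theta-\epsilon^2\cos^2\theta}\,(\cos\theta\cdot y-\sin\theta\cdot x),$$ on the open set where $R(x,y)\neq0$, is a wave map.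
   Context: The metric $dx^2-\epsilon^2dy^2$ is Lorentzian for $\epsilon=1$ and Riemannian for $\epsilon=i$; similarly $h$ is Lorentzian for $\delta=1$ and Riemannian for $\delta=i$. A smooth map $u=(R,S)$ from a surface with metric $dx^2-\epsilon^2dy^2$ to a surface with metric $A(R)dR^2-\delta^2B(R)dS^2$ ($A,B$ smooth and positive) is called harmonic, or a wave map, if it is a critical point (with respect to smooth compactly supported variations of $(R,S)$) of the energy, which up to a positive constant factor is (using $\epsilon^{-2}=\epsilon^2$) $$E(u)=\int\Bigl(A(R)(R_x^2-\epsilon^2R_y^2)-\delta^2B(R)(S_x^2-\epsilon^2S_y^2)\Bigr)dx\,dy;$$ here $A(R)=1$ and $B(R)=\tanh^2R$. In this statement ''wave map'' is used for a critical point of $E$ for either value of $\epsilon$. *)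

(* Defs.v *)
From HB Require Import structures.
From mathcomp Require Import all_boot all_order all_algebra.
From mathcomp Require Import complex.
From mathcomp Require Import all_classical all_reals all_analysis.
Set Implicit Arguments.
Unset Strict Implicit.
Unset Printing Implicit Defensive.
Import Order.TTheory GRing.Theory Num.Theory.
Import numFieldNormedType.Exports.
Local Open Scope classical_set_scope.
Local Open Scope ring_scope.

(* MathComp-Analysis has no hyperbolic functions. *)
Definition sinh (R : realType) (x : R) : R := (expR x - expR (- x)) / 2.
Definition cosh (R : realType) (x : R) : R := (expR x + expR (- x)) / 2.
Definition tanh (R : realType) (x : R) : R := sinh x / cosh x.
Definition arsinh (R : realType) (x : R) : R := ln (x + Num.sqrt (x ^+ 2 + 1)).

Lemma arsinhK (R : realType) : cancel (@arsinh R) (@sinh R).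
Proof.
move=> x; rewrite /arsinh /sinh.
set s := Num.sqrt _.
have hs : s ^+ 2 = x ^+ 2 + 1.
  by rewrite sqr_sqrtr // addr_ge0 ?ler01 // sqr_ge0.
have hp : (x + s) * (s - x) = 1.
  by rewrite [x + s]addrC mulrC -subr_sqr hs addrAC subrr add0r.
have hlt : 0 < x + s.
  have : `|x| < s.
    by rewrite -sqrtr_sqr /s ltr_sqrt ?ltrDl ?ltr01 // ltr_wpDl ?sqr_ge0 ?ltr01.
  by rewrite ltr_norml => /andP[+ _]; rewrite -subr_gt0 opprK addrC.
rewrite expRN lnK ?posrE //.
have -> : (x + s)^-1 = s - x.
  by apply: (mulfI (lt0r_neq0 hlt)); rewrite hp mulfV ?lt0r_neq0.
by rewrite opprB addrACA subrr addr0 mulrDl -splitr.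
Qed.

(* For e = 1 or e = i, the square e^2 is the real number 1 or -1. *)
Definition re_sqr (R : realType) (e : R[i]) : R := complex.Re (e ^+ 2).

Lemma re_sqr1 (R : realType) : re_sqr (1 : R[i]) = 1.
Proof. by rewrite /re_sqr expr1n. Qed.

Lemma re_sqri (R : realType) : re_sqr ('i%C : R[i]) = -1.
Proof. by rewrite /re_sqr sqr_i. Qed.

(* f is of class C^k on U, for U open in a finite-dimensional space: all
   iterated directional derivatives of order at most k exist and are continuous
   on U.  Directional derivatives at the points of an open set U only depend on
   the values of f on U. *)
Fixpoint class_C (R : realType) (V W : normedModType R) (k : nat) (U : set V)
    (f : V -> W) : Prop :=
  (forall p, U p -> {for p, continuous f}) /\
  if k is k'.+1 then
    forall v : V, (forall p, U p -> derivable f p v) /\ class_C k' U ('D_v f)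
  else True.

Definition smooth_on (R : realType) (V W : normedModType R) (U : set V)
    (f : V -> W) : Prop :=
  forall k, class_C k U f.

Definition partial_x (R : realType) (f : R * R -> R) : R * R -> R :=
  'D_((1, 0) : R * R) f.
Definition partial_y (R : realType) (f : R * R -> R) : R * R -> R :=
  'D_((0, 1) : R * R) f.

(* Energy on K of the map (r, s) from the metric dx^2 - eps^2 dy^2 to the metric
   A(r) dr^2 - delta^2 B(r) ds^2. *)
Definition energy_density (R : realType) (eps delta : R[i]) (A B : R -> R)
    (r s : R * R -> R) (p : R * R) : R :=
  A (r p) * (partial_x r p ^+ 2 - re_sqr eps * partial_y r p ^+ 2)
  - re_sqr delta * B (r p) *
    (partial_x s p ^+ 2 - re_sqr eps * partial_y s p ^+ 2).

Definition energy (R : realType) (eps delta : R[i]) (A B : R -> R)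
    (K : set (R * R)) (r s : R * R -> R) : R :=
  Rintegral (lebesgue_measure \x lebesgue_measure)%E K
    (energy_density eps delta A B r s).

(* (rt, st) is a smooth family, with parameter t in ]-eta, eta[, of maps from U
   to the coordinate domain {(r, s) | r in J}; it deforms (r, s) and is constant
   outside K. *)
Record variation (R : realType) (U : set (R * R)) (J : set R)
    (r s : R * R -> R) (K : set (R * R)) (eta : R)
    (rt st : R * (R * R) -> R) : Prop := Variation {
  variation_smooth_r : smooth_on [set q | `|q.1| < eta /\ U q.2] rt ;
  variation_smooth_s : smooth_on [set q | `|q.1| < eta /\ U q.2] st ;
  variation_range : forall t p, `|t| < eta -> U p -> J (rt (t, p)) ;
  variation_start : forall p, U p -> rt (0, p) = r p /\ st (0, p) = s p ;
  variation_support : forall t p, `|t| < eta -> U p -> ~ K p ->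
    rt (t, p) = r p /\ st (t, p) = s p }.

(* The energy on all of U may diverge; since a variation is constant outside the
   compact set K, only the energy on K varies. *)
Definition wave_map (R : realType) (eps delta : R[i]) (A B : R -> R)
    (U : set (R * R)) (J : set R) (r s : R * R -> R) : Prop :=
  [/\ open U, smooth_on U r, smooth_on U s, (forall p, U p -> J (r p)) &
   forall (K : set (R * R)) (eta : R) (rt st : R * (R * R) -> R),
     compact K -> K `<=` U -> 0 < eta -> variation U J r s K eta rt st ->
     is_derive (0 : R) (1 : R)
       (fun t : R => energy eps delta A B K
          (fun p => rt (t, p)) (fun p => st (t, p))) 0].

Definition mapR (R : realType) (eps : R[i]) (theta : R) (p : R * R) : R :=
  arsinh ((cos theta * p.2 - sin theta * p.1)
          / (cos theta ^+ 2 - re_sqr eps * sin theta ^+ 2)).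

Definition mapS (R : realType) (eps : R[i]) (theta : R) (p : R * R) : R :=
  cos theta * p.1 + sin theta * p.2
  + (1 + re_sqr eps) * cos theta * sin theta
    / (sin theta ^+ 2 - re_sqr eps * cos theta ^+ 2)
    * (cos theta * p.2 - sin theta * p.1).

(* Main.v *)
Require Import Defs.
From mathcomp Require Import all_boot all_order all_algebra.
From mathcomp Require Import complex.
From mathcomp Require Import all_classical all_reals all_analysis.
From mathcomp Require Import ring lra.
Import Order.TTheory GRing.Theory Num.Theory.
Import numFieldNormedType.Exports.
Local Open Scope classical_set_scope.
Local Open Scope ring_scope.
Local Open Scope complex_scope.

(** Write e = eps^2 and d = delta^2.  Since eps and delta are distinct elements
    of {1, i}, e is 1 or -1 and d = - e.  The proof has two independent halves.

    The first half says that a smooth solution of the Euler-Lagrange equations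
    of the energy is a wave map, for arbitrary coefficients A and B of the
    target metric (wave_map_of_euler_lagrange).  Along a variation supported in
    the compact set K the energy density and its derivative in the parameter t
    are continuous on a neighbourhood of K, so that the derivative of the energy
    is the integral over K of the derivative of the density at t = 0
    (is_derive_integral).  With phi and psi the t-derivatives at t = 0 of the
    two components, and after t-derivatives and space derivatives have been
    exchanged (mixed_derivatives_eq), the Euler-Lagrange equations turn this
    derivative into a divergence P_x + Q_y, where P and Q are linear in phi and
    psi (lagrangian_variation_flux).  As phi and psi vanish outside K, P and Q
    extend by zero to the plane; each term then integrates to 0 by Fubini and
    the fundamental theorem of calculus on lines (integral_partial_eq0).

    The second half checks the Euler-Lagrange equations.  Both maps of the
    statement are built from linear forms: R = arsinh z with z = a x + b y, and
    S = m x + n y.  For g = arsinh' one has g' = - z g^3, tanh R = z g and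
    1 - tanh^2 R = g^2, so that the equation for R is - 2 z g^3 times
      (a^2 - e b^2) - d (m^2 - e n^2) = 0,
    and the equation for S is a multiple of a m - e b n = 0
    (arsinh_linear_wave_map).  With c = cos theta, s = sin theta and
    D = c^2 - e s^2, the coefficients are a = - s / D, b = c / D, m = c / D and
    n = - e s / D: the second map only looks more complicated in the statement
    because it is written there as a perturbation of c x + s y.  Both scalar
    identities are then immediate from e^2 = 1 and d = - e. *)

Set Implicit Arguments.
Unset Strict Implicit.
Unset Printing Implicit Defensive.

(** * Directional derivatives *)

(** Restriction to a line reduces a directional derivative to a derivative at 0,
    which gives access to the chain rule and to the mean value theorem for
    functions of one real variable. *)
Lemma is_derive_line (R : realType) (V : normedModType R) (f : V -> R)
    (x v : V) (df : R) :
  is_derive x v f df <-> is_derive (0 : R) 1 (fun h => f (h *: v + x)) df.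
Proof.
have E : 'D_v f x = 'D_1 (fun h : R => f (h *: v + x)) 0.
  rewrite /derive; set g := (X in _ = lim (X @ _)).
  suff -> : (fun h => h^-1 *: ((f \o shift x) (h *: v) - f x)) = g by [].
  by apply/funext => h; rewrite /g /= addr0 scale0r add0r [_%:A]mulr1.
have P := derivable1P f x v.
split=> -[d dE].
  by apply: DeriveDef; [apply: P.1|rewrite -E].
by apply: DeriveDef; [apply: P.2|rewrite E].
Qed.

Lemma is_derive_line_at (R : realType) (V : normedModType R) (f : V -> R)
    (x v : V) (t df : R) :
  is_derive (t *: v + x) v f df ->
  is_derive t 1 (fun h => f (h *: v + x)) df.
Proof.
move=> /is_derive_line H; apply/is_derive_line.
rewrite (_ : (fun h => _) = (fun h => f (h *: v + (t *: v + x)))) //.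
by apply/funext => h; rewrite scalerDl [_%:A]mulr1 addrA.
Qed.

Lemma is_derive_comp_dir (R : realType) (V : normedModType R) (f : V -> R)
    (g : R -> R) (x v : V) (df dg : R) :
  is_derive x v f df -> is_derive (f x) 1 g dg ->
  is_derive x v (fun y => g (f y)) (dg * df).
Proof.
move=> /is_derive_line Hf Hg; apply/is_derive_line.
apply: (@is_derive1_comp _ g (fun h => f (h *: v + x))) => //.
by rewrite scale0r add0r.
Qed.

Lemma is_derive_slice_left (R : realType) (V W : normedModType R)
    (f : V * W -> R) (t v : V) (p : W) (df : R) :
  is_derive (t, p) ((v, 0) : V * W) f df ->
  is_derive t v (fun t => f (t, p)) df.
Proof.
move=> /is_derive_line H; apply/is_derive_line.
rewrite (_ : (fun h : R => _) = (fun h : R => f (h *: (v, 0) + (t, p)))) //.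
apply/funext => h; congr f; apply: injective_projections => //=.
by rewrite scaler0 add0r.
Qed.

Lemma is_derive_slice_right (R : realType) (V W : normedModType R)
    (f : V * W -> R) (t : V) (p v : W) (df : R) :
  is_derive (t, p) ((0, v) : V * W) f df ->
  is_derive p v (fun p => f (t, p)) df.
Proof.
move=> /is_derive_line H; apply/is_derive_line.
rewrite (_ : (fun h : R => _) = (fun h : R => f (h *: (0, v) + (t, p)))) //.
apply/funext => h; congr f; apply: injective_projections => //=.
by rewrite scaler0 add0r.
Qed.

Lemma derive_slice_right (R : realType) (V W : normedModType R) (f : V * W -> R)
    (t : V) (p v : W) :
  'D_v (fun p => f (t, p)) p = 'D_((0, v) : V * W) f (t, p).
Proof.
rewrite /derive; set g := (X in _ = lim (X @ _)).
suff -> : (fun h : R => h^-1 *: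
    (((fun p => f (t, p)) \o shift p) (h *: v) - f (t, p))) = g by [].
apply/funext => h; rewrite /g /=; congr (_ *: (f _ - _)).
by apply: injective_projections => //=; rewrite scaler0 add0r.
Qed.

Lemma continuous_slice_left (R : realType) (V W : normedModType R)
    (f : V * W -> R) (t : V) (p : W) :
  {for (t, p), continuous f} -> {for t, continuous (fun t => f (t, p))}.
Proof.
move=> fc; apply: (@continuous_comp _ _ _ (fun t => (t, p)) f) => //.
by apply: cvg_pair => //=; exact: cvg_cst.
Qed.

Lemma continuous_slice_right (R : realType) (V W : normedModType R)
    (f : V * W -> R) (t : V) (p : W) :
  {for (t, p), continuous f} -> {for p, continuous (fun p => f (t, p))}.
Proof.
move=> fc; apply: (@continuous_comp _ _ _ (fun p => (t, p)) f) => //.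
by apply: cvg_pair => //=; exact: cvg_cst.
Qed.

Lemma continuous_near_dist (R : realType) (T : topologicalType) (g : T -> R)
    (p : T) (e : R) :
  {for p, continuous g} -> 0 < e -> \forall q \near p, `|g p - g q| < e.
Proof. by move=> gp e0; exact: (cvgr_dist_lt g (g p) gp e e0). Qed.

(** The second difference of f over the parallelogram spanned by h v and h w is
    h^2 times a mixed derivative at some point of it: the mean value theorem is
    applied in the direction v to the difference of two parallel sides, then in
    the direction w to the derivative. *)
Lemma second_difference_mvt (R : realType) (V : normedModType R)
    (f fv fvw : V -> R) (p v w : V) (h : R) :
  0 < h ->
  (forall s t : R, s \in `[0, h] -> t \in `[0, h] ->
     is_derive (p + s *: v + t *: w) v f (fv (p + s *: v + t *: w)) /\
     is_derive (p + s *: v + t *: w) w fv (fvw (p + s *: v + t *: w))) ->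
  exists s t : R, [/\ s \in `[0, h], t \in `[0, h] &
    f (p + h *: v + h *: w) - f (p + h *: v) - (f (p + h *: w) - f p)
    = fvw (p + s *: v + t *: w) * h ^+ 2].
Proof.
move=> h0 H.
have I0 : 0 \in `[0, h] by rewrite in_itv/= lexx ltW.
have Ih : h \in `[0, h] by rewrite in_itv/= lexx ltW.
pose line (q : V) (s : R) : R := f (s *: v + q).
have dline (t s : R) : t \in `[0, h] -> s \in `[0, h] ->
    is_derive s 1 (line (p + t *: w)) (fv (p + s *: v + t *: w)).
  move=> It Is; apply: is_derive_line_at.
  rewrite addrA [s *: v + p]addrC; exact: (H s t Is It).1.
pose g (s : R) : R := line (p + h *: w) s - line (p + 0 *: w) s.
pose g' (s : R) : R := fv (p + s *: v + h *: w) - fv (p + s *: v + 0 *: w).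
have dg (s : R) : s \in `[0, h] -> is_derive s 1 g (g' s).
  by move=> Is; apply: is_deriveB; exact: dline.
have g1 (x : R) : x \in `]0, h[ -> is_derive x 1 g (g' x).
  by move=> xI; apply: dg; apply: subset_itv_oo_cc xI.
have g2 : {within `[0, h], continuous g}.
  by apply: derivable_within_continuous => x xI; have [] := dg x xI.
have [s Is gE] := MVT_segment (ltW h0) g1 g2.
pose k (t : R) : R := fv (t *: w + (p + s *: v)).
pose k' (t : R) : R := fvw (p + s *: v + t *: w).
have dk (t : R) : t \in `[0, h] -> is_derive t 1 k (k' t).
  move=> It; apply: is_derive_line_at; rewrite addrC.
  exact: (H s t Is It).2.
have k1 (x : R) : x \in `]0, h[ -> is_derive x 1 k (k' x).
  by move=> xI; apply: dk; apply: subset_itv_oo_cc xI.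
have k2 : {within `[0, h], continuous k}.
  by apply: derivable_within_continuous => x xI; have [] := dk x xI.
have [t It kE] := MVT_segment (ltW h0) k1 k2.
exists s, t; split => //.
rewrite expr2 mulrA -[h in X in _ * X * _]subr0 -kE.
have -> : k h - k 0 = g' s.
  by rewrite /k /g' !scale0r add0r addr0 [h *: w + _]addrC.
move: gE; rewrite /g /line subr0 !scale0r !add0r !addr0 => <-.
rewrite [h *: v + p]addrC [h *: v + (p + _)]addrC [p + h *: w + _]addrAC.
by ring.
Qed.

(** Schwarz's theorem.  The second difference is symmetric in v and w, so that
    both mixed derivatives take a common value at points arbitrarily close
    to p. *)
Lemma mixed_derivatives_eq (R : realType) (V : normedModType R)
    (f fv fw fvw fwv : V -> R) (p v w : V) :
  (\forall q \near p, is_derive q v f (fv q) /\ is_derive q w fv (fvw q)) ->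
  (\forall q \near p, is_derive q w f (fw q) /\ is_derive q v fw (fwv q)) ->
  {for p, continuous fvw} -> {for p, continuous fwv} ->
  fvw p = fwv p.
Proof.
move=> N1 N2 C1 C2; apply/eqP/negPn/negP => neq.
pose e : R := `|fvw p - fwv p| / 2.
have e0 : 0 < e by rewrite divr_gt0 // normr_gt0 subr_eq0.
have M1 := continuous_near_dist C1 e0.
have M2 := continuous_near_dist C2 e0.
have : \forall q \near p, [/\
    is_derive q v f (fv q) /\ is_derive q w fv (fvw q),
    is_derive q w f (fw q) /\ is_derive q v fw (fwv q),
    `|fvw p - fvw q| < e & `|fwv p - fwv q| < e].
  by near=> q; split; near: q.
move=> /nbhs_ballP[d /= d0 good].
(* with h = d / (2 m), every p + s v + t w with s, t in [0, h] is in the ball *)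
pose m : R := `|v| + `|w| + 1; have m0 : 0 < m by rewrite ltr_wpDl // addr_ge0.
pose h : R := d / m / 2; have h0 : 0 < h by rewrite !divr_gt0.
have inball (s t : R) : s \in `[0, h] -> t \in `[0, h] ->
    ball p d (p + s *: v + t *: w).
  move=> /[!in_itv]/= /andP[s0 sh] /andP[t0 th].
  rewrite -ball_normE /= -addrA opprD addNKr normrN.
  rewrite (le_lt_trans (ler_normD _ _)) // !normrZ !ger0_norm //.
  apply: (@le_lt_trans _ _ (h * (`|v| + `|w|))).
    by rewrite mulrDr lerD // ler_wpM2r.
  apply: (@lt_le_trans _ _ (h * (m * 2))).
    by rewrite ltr_pM2l // /m; have := normr_ge0 v; have := normr_ge0 w; lra.
  by rewrite /h [m * 2]mulrC mulrA !divfK ?pnatr_eq0 // gt_eqF.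
have H1 (s t : R) : s \in `[0, h] -> t \in `[0, h] ->
    is_derive (p + s *: v + t *: w) v f (fv (p + s *: v + t *: w)) /\
    is_derive (p + s *: v + t *: w) w fv (fvw (p + s *: v + t *: w)).
  by move=> Is It; have [] := good _ (inball s t Is It).
have H2 (s t : R) : s \in `[0, h] -> t \in `[0, h] ->
    is_derive (p + s *: w + t *: v) w f (fw (p + s *: w + t *: v)) /\
    is_derive (p + s *: w + t *: v) v fw (fwv (p + s *: w + t *: v)).
  by move=> Is It; rewrite addrAC; have [] := good _ (inball t s It Is).
have [s [t [Is It E1]]] := second_difference_mvt h0 H1.
have [s' [t' [Is' It' E2]]] := second_difference_mvt h0 H2.
have [_ _ A1 _] := good _ (inball s t Is It).
have [_ _ _ B1] := good _ (inball t' s' It' Is').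
have EQ : fvw (p + s *: v + t *: w) = fwv (p + t' *: v + s' *: w).
  apply: (mulIf (x := h ^+ 2)); first by rewrite expf_neq0 // gt_eqF.
  rewrite -E1 [p + t' *: v + _]addrAC -E2 [p + h *: w + _]addrAC.
  by ring.
have : `|fvw p - fwv p| < e + e.
  rewrite -(subrKA (fvw (p + s *: v + t *: w)) (fvw p) (- fwv p)).
  rewrite (le_lt_trans (ler_normD _ _)) // ltrD // EQ distrC //.
by rewrite /e -splitr ltxx.
Unshelve. all: by end_near. Qed.

(** The library rules for continuity are stated for f + g, - f and f * g as
    functions.  The pointwise forms below match formulas under a binder, so that
    the continuity of a long formula is a term that follows its syntax. *)
Lemma cont_add (R : realType) (V : normedModType R) (f g : V -> R) (p : V) :
  {for p, continuous f} -> {for p, continuous g} ->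
  {for p, continuous (fun x => (f x + g x : R))}.
Proof. exact: continuousD. Qed.

Lemma cont_opp (R : realType) (V : normedModType R) (f : V -> R) (p : V) :
  {for p, continuous f} -> {for p, continuous (fun x => (- f x : R))}.
Proof. exact: continuousN. Qed.

Lemma cont_mul (R : realType) (V : normedModType R) (f g : V -> R) (p : V) :
  {for p, continuous f} -> {for p, continuous g} ->
  {for p, continuous (fun x => (f x * g x : R))}.
Proof. exact: continuousM. Qed.

Lemma cont_sqr (R : realType) (V : normedModType R) (f : V -> R) (p : V) :
  {for p, continuous f} -> {for p, continuous (fun x => (f x ^+ 2 : R))}.
Proof. by move=> cf; exact: (cont_mul cf cf). Qed.

Lemma cont_cst (R : realType) (V : normedModType R) (c : R) (p : V) :
  {for p, continuous (fun _ : V => (c : R))}.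
Proof. exact: cst_continuous. Qed.
Arguments cont_cst {R V} c p.

Lemma cont_comp (R : realType) (V : normedModType R) (F : R -> R) (f : V -> R)
    (p : V) :
  {for f p, continuous F} -> {for p, continuous f} ->
  {for p, continuous (fun x => (F (f x) : R))}.
Proof. by move=> cF cf; exact: continuous_comp. Qed.

(** * Lebesgue measure and integration in the plane *)

Local Notation plane R := (measurableTypeR R * measurableTypeR R)%type.
Local Notation lebesgue2 R :=
  ((@lebesgue_measure R) \x (@lebesgue_measure R))%E.

(** The measurable sets of the plane are generated by rectangles; an open set is
    the countable union of the rectangles with rational corners in it. *)
Lemma open_plane_measurable (R : realType) (A : set (R * R)) :
  open A -> measurable (A : set (plane R)).
Proof.
move=> oA.
pose box (q : (rat * rat) * (rat * rat)) : set (R * R) :=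
  `]ratr q.1.1, ratr q.1.2[ `*` `]ratr q.2.1, ratr q.2.2[.
have -> : A = \bigcup_q (if `[< box q `<=` A >] then box q else set0).
  apply/seteqP; split=> [p Ap|p [q _]]; last first.
    by case: asboolP => // qA bp; exact: qA.
  have /nbhs_ballP[e /= e0 peA] : nbhs p A by exact: open_nbhs_nbhs.
  have [a] := @rat_in_itvoo R (p.1 - e) p.1 ltac:(by rewrite ltrBlDr ltrDl).
  rewrite in_itv/= => /andP[a1 a2].
  have [b] := @rat_in_itvoo R p.1 (p.1 + e) ltac:(by rewrite ltrDl).
  rewrite in_itv/= => /andP[b1 b2].
  have [c] := @rat_in_itvoo R (p.2 - e) p.2 ltac:(by rewrite ltrBlDr ltrDl).
  rewrite in_itv/= => /andP[c1 c2].
  have [d] := @rat_in_itvoo R p.2 (p.2 + e) ltac:(by rewrite ltrDl).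
  rewrite in_itv/= => /andP[d1 d2].
  exists ((a, b), (c, d)) => //; case: asboolP => [_|nsub].
    by split; rewrite /= in_itv/=; apply/andP.
  exfalso; apply: nsub => -[x y] [] /=; rewrite !in_itv/=.
  move=> /andP[ax xb] /andP[cy yd]; apply: peA; split;
    rewrite /ball/= /ball/= ltr_norml; apply/andP; split; lra.
apply: countable_bigcupT_measurable; first exact: countableP.
move=> q; case: ifP => _; last exact: measurable0.
by apply: measurableX; exact: measurable_itv.
Qed.

Lemma compact_plane_measurable (R : realType) (K : set (R * R)) :
  compact K -> measurable (K : set (plane R)).
Proof.
move=> /compact_closed => /(_ (@norm_hausdorff _ (R * R)%type)).
move=> /closed_openC oK.
rewrite -[K]setCK; apply: measurableC; exact: open_plane_measurable.
Qed.

Lemma compact_plane_bounded (R : realType) (K : set (R * R)) : compact K ->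
  exists2 m : R, 0 < m & forall p, K p -> `|p.1| < m /\ `|p.2| < m.
Proof.
move=> /compact_bounded[N [_ KN]].
exists (`|N| + 2); first by rewrite ltr_wpDl.
move=> p Kp; have : `|p| <= `|N| + 1.
  by apply: KN => //; rewrite ltr_pwDr // ler_norm.
rewrite /Num.norm/= ge_max => /andP[p1 p2].
by split; [apply: le_lt_trans p1 _|apply: le_lt_trans p2 _];
  rewrite ltrD2l ltr1n.
Qed.

Lemma compact_plane_finite_measure (R : realType) (K : set (R * R)) :
  compact K -> (lebesgue2 R K < +oo)%E.
Proof.
move=> cK; have [m m0 Km] := compact_plane_bounded cK.
pose S : set (plane R) := `[-m, m] `*` `[-m, m].
have sub : K `<=` S.
  by move=> p /Km[p1 p2]; split; rewrite /= in_itv/= -ler_norml ltW.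
have mS : measurable S by apply: measurableX; exact: measurable_itv.
have mK := compact_plane_measurable cK.
have le : (lebesgue2 R K <= lebesgue2 R S)%E.
  by apply: le_measure => //; rewrite inE.
apply: (le_lt_trans le).
have I_fin : (@lebesgue_measure R `[(- m)%R, m]%classic < +oo)%E.
  exact: compact_finite_measure (@segment_compact _ _ _).
have -> : lebesgue2 R S = (@lebesgue_measure R `[(- m)%R, m]%classic *
                           @lebesgue_measure R `[(- m)%R, m]%classic)%E.
  by apply: product_measure1E; exact: measurable_itv.
by apply: lte_mul_pinfty => //; rewrite ge0_fin_numE.
Qed.

Lemma continuous_plane_integrable (R : realType) (K U : set (R * R))
    (f : R * R -> R) :
  compact K -> open U -> K `<=` U -> (forall p, U p -> {for p, continuous f}) ->
  (lebesgue2 R).-integrable K (EFin \o f).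
Proof.
move=> cK oU KU cf.
have fK : {within K, continuous f}.
  apply: (continuous_subspaceW KU); rewrite continuous_open_subspace // => p.
  by rewrite inE; exact: cf.
apply: measurable_bounded_integrable.
- exact: compact_plane_measurable.
- exact: compact_plane_finite_measure.
- apply: (measurability _ (measurable_realfun.RGenOpens.measurableE R)).
  move=> _ [_ [a [b ->]] <-].
  rewrite (_ : K `&` _ = K `&` (U `&` f @^-1` `]a, b[%classic)).
    apply: measurableI; first exact: compact_plane_measurable.
    apply: open_plane_measurable; rewrite openE => p [Up fp].
    apply: filterI; first exact: open_nbhs_nbhs.
    apply: (cf p Up); apply: open_nbhs_nbhs; split => //; exact: interval_open.
  by rewrite setIA; congr (_ `&` _); apply/esym/setIidl.
- have /compact_bounded[M [_ mrt]] := continuous_compact fK cK.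
  by exists M; split; rewrite ?num_real // => ? ? ? ?; exact: mrt.
Qed.

(** Differentiation under the integral sign.  The domination comes from
    compactness: ft is bounded on [- eta / 2, eta / 2] x K. *)
Lemma is_derive_integral (R : realType) (K U : set (R * R)) (eta : R)
    (f ft : R * (R * R) -> R) :
  compact K -> open U -> K `<=` U -> 0 < eta ->
  (forall q, `|q.1| < eta -> U q.2 ->
    [/\ is_derive q ((1, 0) : R * (R * R)) f (ft q),
        {for q, continuous f} & {for q, continuous ft}]) ->
  is_derive (0 : R) 1
    (fun t : R => Rintegral (lebesgue2 R) K (fun p => f (t, p)))
    (Rintegral (lebesgue2 R) K (fun p => ft (0, p))).
Proof.
move=> cK oU KU eta0 H.
pose d : R := eta / 2.
have d0 : 0 < d by rewrite divr_gt0.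
have deta : d < eta by rewrite /d ltr_pdivrMr // ltr_pMr // ltr1n.
pose Q : set (R * (R * R)) := `[-d, d] `*` K.
have QP q : Q q -> `|q.1| < eta /\ U q.2.
  case; rewrite /= in_itv/= -ler_norml => qd /KU; split => //.
  exact: le_lt_trans deta.
have cQ : compact Q by apply: compact_setX => //; exact: segment_compact.
have ftQ : {within Q, continuous ft}.
  apply/subspace_continuousP => q /QP[q1 q2].
  by apply: cvg_within_filter; have [_ _] := H q q1 q2.
have [M M0 ftM] : exists2 M : R, 0 <= M & forall q, Q q -> `|ft q| <= M.
  have /compact_bounded[N [_ mrt]] := continuous_compact ftQ cQ.
  exists (`|N| + 1); first by rewrite addr_ge0.
  by move=> q Qq; apply: mrt; [rewrite ltr_pwDr // ler_norm|exists q].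
have smallt (t : R) : `]- d, d[%classic t -> `|t| < eta.
  rewrite /= in_itv/= => /andP[t1 t2].
  by rewrite (lt_trans _ deta) // ltr_norml t1 t2.
have mK := compact_plane_measurable cK.
have I0 : `]- d, d[%classic (0 : R) by rewrite /= in_itv/= oppr_lt0 d0.
have intf (t : R) : `]- d, d[%classic t ->
    (lebesgue2 R).-integrable K (EFin \o (fun p => f (t, p))).
  move=> /smallt td; apply: (continuous_plane_integrable cK oU KU) => p Up.
  by apply: continuous_slice_right; have [] := H (t, p) td Up.
have dert (t : R) (p : plane R) : `]- d, d[%classic t -> K p ->
    is_derive t 1 (fun t => f (t, p)) (ft (t, p)).
  move=> /smallt td /KU Up; apply: is_derive_slice_left.
  by have [] := H (t, p) td Up.
have d1E (t : R) (p : plane R) : `]- d, d[%classic t -> K p ->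
    partial1of2 (fun t p => f (t, p)) t p = ft (t, p).
  by move=> td Kp; rewrite partial1of2E; have [] := dert t p td Kp.
have derf (t : R) (p : plane R) : `]- d, d[%classic t -> K p ->
    derivable ((fun t p => f (t, p)) ^~ p) t 1.
  by move=> td Kp; have [] := dert t p td Kp.
have intM : (lebesgue2 R).-integrable K (EFin \o (fun _ : plane R => M)).
  apply: (continuous_plane_integrable cK oU KU) => p _.
  exact: cst_continuous.
have bnd (t : R) (p : plane R) : `]- d, d[%classic t -> K p ->
    `|partial1of2 (fun t p => f (t, p)) t p| <= M.
  move=> td Kp; rewrite d1E //; apply: ftM; split => //=.
  exact: subset_itv_oo_cc td.
apply: DeriveDef.
  exact: (derivable_under_integral mK I0 intf derf (fun=> M0) intM bnd).
rewrite -derive1E.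
rewrite (differentiation_under_integral mK I0 intf derf (fun=> M0) intM bnd).
by apply: eq_Rintegral => p; rewrite inE => Kp; rewrite d1E.
Qed.

(** Every point has a neighbourhood contained in U or in the complement of K;
    the extension by zero of P is P on the former and 0 on the latter. *)
Lemma extend_by_zero (R : realType) (K U : set (R * R)) (v : R * R)
    (P Pv : R * R -> R) :
  compact K -> open U -> K `<=` U ->
  (forall p, U p -> is_derive p v P (Pv p) /\ {for p, continuous Pv}) ->
  (forall p, U p -> ~ K p -> P p = 0) ->
  exists F G : R * R -> R,
    [/\ forall p, is_derive p v F (G p), continuous G,
        forall p, ~ K p -> F p = 0 /\ G p = 0 & forall p, K p -> G p = Pv p].
Proof.
move=> cK oU KU dP P0.
have oKC : open (~` K).
  exact/closed_openC/(compact_closed (@norm_hausdorff _ (R * R)%type)).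
have Pv0 p : U p -> ~ K p -> Pv p = 0.
  move=> Up Kp; have [_ <-] := (dP p Up).1.
  rewrite (@near_eq_derive _ _ _ P (cst 0)) ?derive_cst //.
  have : \forall q \near p, U q /\ ~ K q.
    by apply: filterI; exact: open_nbhs_nbhs.
  by apply: filterS => q [? ?]; exact: P0.
pose F p := if `[< U p >] then P p else 0.
pose G p := if `[< U p >] then Pv p else 0.
have FG0 p : ~ K p -> F p = 0 /\ G p = 0.
  by move=> Kp; rewrite /F /G; case: asboolP => // Up; rewrite P0 // Pv0.
have inU p : U p -> \forall q \near p, P q = F q /\ Pv q = G q.
  move=> Up; have : nbhs p U by exact: open_nbhs_nbhs.
  by apply: filterS => q Uq; rewrite /F /G; case: asboolP.
have offK p : ~ U p -> \forall q \near p, cst 0 q = F q /\ cst 0 q = G q.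
  move=> Up; have : nbhs p (~` K).
    by apply: open_nbhs_nbhs; split => // /KU.
  by apply: filterS => q /FG0[-> ->].
exists F, G; split => //.
- move=> p; have [Up|Up] := pselect (U p).
    apply: (@near_eq_is_derive _ _ _ P).
      by apply: filterS (inU p Up) => q [].
    by have [_ <-] := nbhs_singleton (inU p Up); exact: (dP p Up).1.
  apply: (@near_eq_is_derive _ _ _ (cst 0)).
    by apply: filterS (offK p Up) => q [].
  by have [_ <-] := nbhs_singleton (offK p Up); exact: is_derive_cst.
- move=> p; have [Up|Up] := pselect (U p).
    have E := nbhs_singleton (inU p Up); rewrite /continuous_at -E.2.
    apply: cvg_trans (dP p Up).2; apply: near_eq_cvg.
    by apply: filterS (inU p Up) => q [].
  have E := nbhs_singleton (offK p Up); rewrite /continuous_at -E.2.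
  have : cst (0 : R) q @[q --> p] --> (0 : R) by exact: cvg_cst.
  by apply: cvg_trans; apply: near_eq_cvg; apply: filterS (offK p Up) => q [].
- by move=> p /KU Up; rewrite /G; case: asboolP.
Qed.

Lemma integral_derivative_eq0 (R : realType) (F g : R -> R) (m : R) :
  0 < m -> (forall x : R, is_derive x 1 F (g x)) -> continuous g ->
  (forall x, m <= `|x| -> F x = 0 /\ g x = 0) ->
  (\int[@lebesgue_measure R]_x (g x)%:E = 0)%E.
Proof.
move=> m0 dF cg out.
have -> : (\int[@lebesgue_measure R]_x (g x)%:E =
           \int[@lebesgue_measure R]_(x in `[(- m)%R, m]) (g x)%:E)%E.
  rewrite [RHS]integral_mkcond; apply: eq_integral => x _.
  rewrite patchE; case: ifPn => //; rewrite notin_setE /= in_itv/= -ler_norml.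
  by move=> /negP; rewrite -ltNge => /ltW /out[_ ->].
have cF : continuous F.
  move=> x; have [dx _] := dF x.
  exact/differentiable_continuous/derivable1_diffP.
rewrite (@continuous_FTC2 R g F).
- have [-> _] : F m = 0 /\ g m = 0 by apply: out; rewrite gtr0_norm.
  have [-> _] : F (- m) = 0 /\ g (- m) = 0.
    by apply: out; rewrite normrN gtr0_norm.
  by rewrite subee.
- lra.
- exact: continuous_subspaceT.
- split; first by move=> x _; case: (dF x).
    by apply: cvg_at_right_filter; exact: cF.
  by apply: cvg_at_left_filter; exact: cF.
- by move=> x _; rewrite derive1E; case: (dF x).
Qed.

(** The divergence theorem for fields supported in K.  After extension by zero
    the integral over K is an integral over the plane; Fubini's theorem, with
    the variable of differentiation inside, reduces it to lines. *)
Lemma integral_partial_eq0 (R : realType) (K U : set (R * R)) (v : R * R)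
    (P Pv : R * R -> R) :
  v = (1, 0) \/ v = (0, 1) ->
  compact K -> open U -> K `<=` U ->
  (forall p, U p -> is_derive p v P (Pv p) /\ {for p, continuous Pv}) ->
  (forall p, U p -> ~ K p -> P p = 0) ->
  Rintegral (lebesgue2 R) K Pv = 0.
Proof.
move=> vE cK oU KU dP P0.
have [F [G [dF cG out GE]]] := extend_by_zero cK oU KU dP P0.
have [m m0 Km] := compact_plane_bounded cK.
have mK := compact_plane_measurable cK.
have GK : G \_ K = G.
  apply/funext => p; rewrite patchE; case: ifPn => //.
  by rewrite notin_setE => /out[_ ->].
have iG : (lebesgue2 R).-integrable setT (EFin \o G).
  have := continuous_plane_integrable cK openT (@subsetT _ K) (fun p _ => cG p).
  rewrite -{2}GK -restrict_EFin => iG.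
  by apply/(integrable_restrict _ mK measurableT); rewrite setTI.
rewrite (_ : Rintegral _ _ _ = Rintegral (lebesgue2 R) K G); last first.
  by apply: eq_Rintegral => p; rewrite inE => /GE.
rewrite Rintegral_mkcond GK /Rintegral.
have zero : (\int[lebesgue2 R]_z (EFin \o G) z = 0)%E.
  case: vE => vE; rewrite vE in dF.
    rewrite -(integral21_prod_meas1 iG); apply: integral0_eq => y _.
    apply: (@integral_derivative_eq0 _ (fun x => F (x, y)) _ m) => //.
    - by move=> x; exact: is_derive_slice_left.
    - by move=> x; apply: continuous_slice_left; exact: cG.
    - by move=> x mx; apply: out => /Km[/=]; rewrite ltNge mx.
  rewrite -(integral12_prod_meas1 iG); apply: integral0_eq => x _.
  apply: (@integral_derivative_eq0 _ (fun y => F (x, y)) _ m) => //.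
  - by move=> y; exact: is_derive_slice_right.
  - by move=> y; apply: continuous_slice_right; exact: cG.
  - by move=> y my; apply: out => /Km[_ /=]; rewrite ltNge my.
by rewrite zero.
Qed.

(** * Smooth functions *)

Lemma smooth_on_continuous (R : realType) (V : normedModType R) (U : set V)
    (f : V -> R) (q : V) :
  smooth_on U f -> U q -> {for q, continuous f}.
Proof. by move=> /(_ 0%N)[cf _] /cf. Qed.

Lemma smooth_on_derive (R : realType) (V : normedModType R) (U : set V)
    (f : V -> R) (v : V) :
  smooth_on U f -> smooth_on U ('D_v f).
Proof. by move=> sf k; have [_ /(_ v)[]] := sf k.+1. Qed.

Lemma smooth_on_is_derive (R : realType) (V : normedModType R) (U : set V)
    (f : V -> R) (v q : V) :
  smooth_on U f -> U q -> is_derive q v f ('D_v f q).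
Proof.
by move=> sf Uq; apply: derivableP; have [_ /(_ v)[df _]] := sf 1%N; exact: df.
Qed.

Lemma smooth_on_derive_comm (R : realType) (V : normedModType R) (U : set V)
    (f : V -> R) (v w q : V) :
  open U -> smooth_on U f -> U q -> 'D_w ('D_v f) q = 'D_v ('D_w f) q.
Proof.
move=> oU sf Uq; have nU : \forall p \near q, U p by exact: open_nbhs_nbhs.
have sD u := smooth_on_derive u sf.
have H1 : \forall p \near q, is_derive p v f ('D_v f p) /\
    is_derive p w ('D_v f) ('D_w ('D_v f) p).
  by apply: filterS nU => p Up; split; exact: smooth_on_is_derive.
have H2 : \forall p \near q, is_derive p w f ('D_w f p) /\
    is_derive p v ('D_w f) ('D_v ('D_w f) p).
  by apply: filterS nU => p Up; split; exact: smooth_on_is_derive.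
have C1 := smooth_on_continuous (smooth_on_derive w (sD v)) Uq.
have C2 := smooth_on_continuous (smooth_on_derive v (sD w)) Uq.
exact: (mixed_derivatives_eq H1 H2 C1 C2).
Qed.

(** * First variation of the energy *)

Definition lagrangian {R : realType} (A B : R -> R)
    (e d r rx ry sx sy : R) : R :=
  A r * (rx ^+ 2 - e * ry ^+ 2) - d * B r * (sx ^+ 2 - e * sy ^+ 2).

(** The differential of lagrangian in its last five arguments, applied to
    (r', rx', ry', sx', sy'). *)
Definition lagrangian_variation {R : realType} (A A' B B' : R -> R)
    (e d r rx ry sx sy r' rx' ry' sx' sy' : R) : R :=
  A' r * r' * (rx ^+ 2 - e * ry ^+ 2) + A r * (2 * (rx * rx' - e * (ry * ry')))
  - d * (B' r * r' * (sx ^+ 2 - e * sy ^+ 2)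
         + B r * (2 * (sx * sx' - e * (sy * sy')))).

Lemma is_derive_lagrangian (R : realType) (V : normedModType R)
    (A A' B B' : R -> R) (e d : R) (r rx ry sx sy : V -> R) (q v : V)
    (r' rx' ry' sx' sy' : R) :
  is_derive (r q) 1 A (A' (r q)) -> is_derive (r q) 1 B (B' (r q)) ->
  is_derive q v r r' -> is_derive q v rx rx' -> is_derive q v ry ry' ->
  is_derive q v sx sx' -> is_derive q v sy sy' ->
  is_derive q v (fun q => lagrangian A B e d (r q) (rx q) (ry q) (sx q) (sy q))
    (lagrangian_variation A A' B B' e d (r q) (rx q) (ry q) (sx q) (sy q)
       r' rx' ry' sx' sy').
Proof.
move=> dA dB dr drx dry dsx dsy.
have dAr := is_derive_comp_dir dr dA; have dBr := is_derive_comp_dir dr dB.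
rewrite /lagrangian; apply: is_derive_eq.
by rewrite /lagrangian_variation /GRing.scale /=; ring.
Qed.

Lemma cont_lagrangian (R : realType) (V : normedModType R)
    (A B : R -> R) (e d : R) (r rx ry sx sy : V -> R) (q : V) :
  {for r q, continuous A} -> {for r q, continuous B} ->
  {for q, continuous r} -> {for q, continuous rx} -> {for q, continuous ry} ->
  {for q, continuous sx} -> {for q, continuous sy} ->
  {for q, continuous
    (fun q => lagrangian A B e d (r q) (rx q) (ry q) (sx q) (sy q))}.
Proof.
move=> cA cB cr crx cry csx csy.
have cAr := cont_comp cA cr; have cBr := cont_comp cB cr.
have grad (f g : V -> R) : {for q, continuous f} -> {for q, continuous g} ->
    {for q, continuous (fun q => (f q ^+ 2 - e * g q ^+ 2 : R))}.
  by move=> cf cg; exact: (cont_add (cont_sqr cf)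
    (cont_opp (cont_mul (cont_cst e q) (cont_sqr cg)))).
exact: (cont_add (cont_mul cAr (grad _ _ crx cry))
  (cont_opp (cont_mul (cont_mul (cont_cst d q) cBr) (grad _ _ csx csy)))).
Qed.

Lemma cont_lagrangian_variation (R : realType) (V : normedModType R)
    (A A' B B' : R -> R) (e d : R)
    (r rx ry sx sy r' rx' ry' sx' sy' : V -> R) (q : V) :
  {for r q, continuous A} -> {for r q, continuous B} ->
  {for r q, continuous A'} -> {for r q, continuous B'} ->
  {for q, continuous r} -> {for q, continuous rx} -> {for q, continuous ry} ->
  {for q, continuous sx} -> {for q, continuous sy} ->
  {for q, continuous r'} -> {for q, continuous rx'} ->
  {for q, continuous ry'} -> {for q, continuous sx'} ->
  {for q, continuous sy'} ->
  {for q, continuous (fun q => lagrangian_variation A A' B B' e d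
    (r q) (rx q) (ry q) (sx q) (sy q) (r' q) (rx' q) (ry' q) (sx' q) (sy' q))}.
Proof.
move=> cA cB cA' cB' cr crx cry csx csy cr' crx' cry' csx' csy'.
have cAr := cont_comp cA cr; have cBr := cont_comp cB cr.
have cA'r := cont_comp cA' cr; have cB'r := cont_comp cB' cr.
have grad (f g : V -> R) : {for q, continuous f} -> {for q, continuous g} ->
    {for q, continuous (fun q => (f q ^+ 2 - e * g q ^+ 2 : R))}.
  by move=> cf cg; exact: (cont_add (cont_sqr cf)
    (cont_opp (cont_mul (cont_cst e q) (cont_sqr cg)))).
have dgrad (f g f' g' : V -> R) :
    {for q, continuous f} -> {for q, continuous g} ->
    {for q, continuous f'} -> {for q, continuous g'} ->
    {for q, continuous (fun q => (2 * (f q * f' q - e * (g q * g' q)) : R))}.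
  move=> cf cg cf' cg'; exact: (cont_mul (cont_cst 2 q)
    (cont_add (cont_mul cf cf')
       (cont_opp (cont_mul (cont_cst e q) (cont_mul cg cg'))))).
exact: (cont_add
  (cont_add (cont_mul (cont_mul cA'r cr') (grad _ _ crx cry))
     (cont_mul cAr (dgrad _ _ _ _ crx cry crx' cry')))
  (cont_opp (cont_mul (cont_cst d q)
     (cont_add (cont_mul (cont_mul cB'r cr') (grad _ _ csx csy))
        (cont_mul cBr (dgrad _ _ _ _ csx csy csx' csy')))))).
Qed.

(** Both components of the field whose divergence is the first variation have
    this shape: phi and psi are the variations of r and s, and c * a * rx and
    - k * b * sx are the momenta conjugate to r and s. *)
Definition flux {R : realType} (c k a b rx sx phi psi : R) : R :=
  c * (a * rx * phi) - k * (b * sx * psi).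

Definition flux_derivative {R : realType}
    (c k a b rx sx phi psi a' b' rx' sx' phi' psi' : R) : R :=
  c * (a' * rx * phi + a * (rx' * phi + rx * phi'))
  - k * (b' * sx * psi + b * (sx' * psi + sx * psi')).

Lemma is_derive_flux (R : realType) (V : normedModType R) (c k : R)
    (a b rx sx phi psi : V -> R) (q v : V) (a' b' rx' sx' phi' psi' : R) :
  is_derive q v a a' -> is_derive q v b b' ->
  is_derive q v rx rx' -> is_derive q v sx sx' ->
  is_derive q v phi phi' -> is_derive q v psi psi' ->
  is_derive q v
    (fun q => flux c k (a q) (b q) (rx q) (sx q) (phi q) (psi q))
    (flux_derivative c k (a q) (b q) (rx q) (sx q) (phi q) (psi q)
       a' b' rx' sx' phi' psi').
Proof.
move=> da db drx dsx dphi dpsi; rewrite /flux; apply: is_derive_eq.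
by rewrite /flux_derivative /GRing.scale /=; ring.
Qed.

Lemma cont_flux_derivative (R : realType) (V : normedModType R) (c k : R)
    (a b rx sx phi psi a' b' rx' sx' phi' psi' : V -> R) (q : V) :
  {for q, continuous a} -> {for q, continuous b} ->
  {for q, continuous rx} -> {for q, continuous sx} ->
  {for q, continuous phi} -> {for q, continuous psi} ->
  {for q, continuous a'} -> {for q, continuous b'} ->
  {for q, continuous rx'} -> {for q, continuous sx'} ->
  {for q, continuous phi'} -> {for q, continuous psi'} ->
  {for q, continuous (fun q => flux_derivative c k (a q) (b q) (rx q) (sx q)
     (phi q) (psi q) (a' q) (b' q) (rx' q) (sx' q) (phi' q) (psi' q))}.
Proof.
move=> ca cb crx csx cphi cpsi ca' cb' crx' csx' cphi' cpsi'.
have term (f g h f' g' h' : V -> R) :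
    {for q, continuous f} -> {for q, continuous g} ->
    {for q, continuous h} -> {for q, continuous f'} ->
    {for q, continuous g'} -> {for q, continuous h'} ->
    {for q, continuous (fun q =>
      (f' q * g q * h q + f q * (g' q * h q + g q * h' q) : R))}.
  move=> cf cg ch cf' cg' ch'; exact: (cont_add (cont_mul (cont_mul cf' cg) ch)
    (cont_mul cf (cont_add (cont_mul cg' ch) (cont_mul cg ch')))).
exact: (cont_add
  (cont_mul (cont_cst c q) (term _ _ _ _ _ _ ca crx cphi ca' crx' cphi'))
  (cont_opp (cont_mul (cont_cst k q)
     (term _ _ _ _ _ _ cb csx cpsi cb' csx' cpsi')))).
Qed.

(** The first variation is a divergence modulo the Euler-Lagrange equations: the
    difference of the two sides is 2 d psi times the equation for s minus phi
    times the equation for r. *)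
Lemma lagrangian_variation_flux (R : realType) (A A' B B' : R -> R)
    (e d r rx ry sx sy rxx ryy sxx syy
     phi phix phiy psi psix psiy : R) :
  2 * A r * (rxx - e * ryy) + A' r * (rx ^+ 2 - e * ry ^+ 2)
    + d * B' r * (sx ^+ 2 - e * sy ^+ 2) = 0 ->
  B r * (sxx - e * syy) + B' r * (rx * sx - e * (ry * sy)) = 0 ->
  lagrangian_variation A A' B B' e d r rx ry sx sy phi phix phiy psix psiy
  = flux_derivative 2 (2 * d) (A r) (B r) rx sx phi psi
      (A' r * rx) (B' r * rx) rxx sxx phix psix
    + flux_derivative (- (2 * e)) (- (2 * d * e)) (A r) (B r) ry sy phi psi
      (A' r * ry) (B' r * ry) ryy syy phiy psiy.
Proof.
set EL1 := (X in X = 0 -> _) => EL1_0; set EL2 := (X in X = 0 -> _) => EL2_0.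
apply/eqP; rewrite -subr_eq0.
rewrite (_ : _ - _ = 2 * d * psi * EL2 - phi * EL1).
  by rewrite EL1_0 EL2_0 !mulr0 subrr.
by rewrite /lagrangian_variation /flux_derivative /EL1 /EL2; ring.
Qed.

(** Used to replace all the arguments at once: they are derivatives that differ
    only by their direction. *)
Lemma lagrangian_variation_congr (R : realType) (A A' B B' : R -> R)
    (e d r rx ry sx sy r' rx' ry' sx' sy'
     u ux uy vx vy u' ux' uy' vx' vy' : R) :
  r = u -> rx = ux -> ry = uy -> sx = vx -> sy = vy ->
  r' = u' -> rx' = ux' -> ry' = uy' -> sx' = vx' -> sy' = vy' ->
  lagrangian_variation A A' B B' e d r rx ry sx sy r' rx' ry' sx' sy'
  = lagrangian_variation A A' B B' e d u ux uy vx vy u' ux' uy' vx' vy'.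
Proof. by do 10! move=> ->. Qed.

(** The variation enters the derivative of the energy at t = 0 only through phi
    and psi, its t-derivatives at t = 0.  The first equation is the
    Euler-Lagrange equation for r, the second one the equation for s divided by
    - 2 d, both with the derivatives of products expanded. *)
Lemma wave_map_of_euler_lagrange (R : realType) (eps delta : R[i])
    (A A' B B' : R -> R) (U : set (R * R)) (J : set R) (r s : R * R -> R) :
  let e := re_sqr eps in let d := re_sqr delta in
  let rx := partial_x r in let ry := partial_y r in
  let sx := partial_x s in let sy := partial_y s in
  open U -> smooth_on U r -> smooth_on U s -> (forall p, U p -> J (r p)) ->
  (forall x, J x -> is_derive x 1 A (A' x) /\ {for x, continuous A'}) ->
  (forall x, J x -> is_derive x 1 B (B' x) /\ {for x, continuous B'}) ->
  (forall p, U p ->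
     2 * A (r p) * (partial_x rx p - e * partial_y ry p)
     + A' (r p) * (rx p ^+ 2 - e * ry p ^+ 2)
     + d * B' (r p) * (sx p ^+ 2 - e * sy p ^+ 2) = 0) ->
  (forall p, U p ->
     B (r p) * (partial_x sx p - e * partial_y sy p)
     + B' (r p) * (rx p * sx p - e * (ry p * sy p)) = 0) ->
  wave_map eps delta A B U J r s.
Proof.
move=> e d rx ry sx sy oU smr sms Jr dA dB EL1 EL2; split => //.
move=> K eta rt st cK KU eta0 [smrt smst range start supp].
pose W : set (R * (R * R)) := [set q | `|q.1| < eta /\ U q.2].
rewrite -/W in smrt smst.
have oW : open W.
  rewrite openE => -[t p] [/= te Up].
  have Ut : nbhs t [set t | `|t| < eta].
    have : nbhs `|t| [set x | x < eta] by exact: lt_nbhsl.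
    exact: (@norm_continuous _ R t).
  have Un : nbhs p U by exact: open_nbhs_nbhs.
  by exists ([set t | `|t| < eta], U).
pose dt : R * (R * R) := (1, 0).
pose dx : R * (R * R) := (0, (1, 0)).
pose dy : R * (R * R) := (0, (0, 1)).
have contW (g : R * (R * R) -> R) q :
    smooth_on W g -> W q -> {for q, continuous g}.
  exact: smooth_on_continuous.
have derW (g : R * (R * R) -> R) v q :
    smooth_on W g -> W q -> is_derive q v g ('D_v g q).
  exact: smooth_on_is_derive.
have smW (g : R * (R * R) -> R) v : smooth_on W g -> smooth_on W ('D_v g).
  exact: smooth_on_derive.
have CA x : J x -> {for x, continuous A}.
  move=> /dA[[dAx _] _]; exact/differentiable_continuous/derivable1_diffP.
have CB x : J x -> {for x, continuous B}.
  move=> /dB[[dBx _] _]; exact/differentiable_continuous/derivable1_diffP.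
have JW q : W q -> J (rt q) by case: q => t p [? ?]; exact: range.
pose f q := lagrangian A B e d
  (rt q) ('D_dx rt q) ('D_dy rt q) ('D_dx st q) ('D_dy st q).
pose ft q := lagrangian_variation A A' B B' e d
  (rt q) ('D_dx rt q) ('D_dy rt q) ('D_dx st q) ('D_dy st q)
  ('D_dt rt q) ('D_dt ('D_dx rt) q) ('D_dt ('D_dy rt) q)
  ('D_dt ('D_dx st) q) ('D_dt ('D_dy st) q).
rewrite (_ : (fun t => _) =
    (fun t => Rintegral (lebesgue2 R) K (fun p => f (t, p)))); last first.
  apply/funext => t; apply: eq_Rintegral => p _.
  by rewrite /energy_density /partial_x /partial_y !derive_slice_right.
apply: is_derive_eq.
  apply: (is_derive_integral (ft := ft) cK oU KU eta0) => q q1 q2.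
  have Wq : W q by [].
  split.
  - apply: is_derive_lagrangian;
      [exact: (dA _ (JW _ Wq)).1|exact: (dB _ (JW _ Wq)).1|..];
      by apply: derW; do ?apply/smW.
  - apply: cont_lagrangian; [exact: CA (JW _ Wq)|exact: CB (JW _ Wq)|..];
      by apply: contW; do ?apply/smW.
  - apply: cont_lagrangian_variation; [exact: CA (JW _ Wq)|exact: CB (JW _ Wq)
      |exact: (dA _ (JW _ Wq)).2|exact: (dB _ (JW _ Wq)).2|..];
      by apply: contW; do ?apply/smW.
pose phi p := 'D_dt rt (0, p); pose psi p := 'D_dt st (0, p).
have W0 p : U p -> W (0, p) by move=> Up; split => //=; rewrite normr0.
have start_r v (p : R * R) :
    U p -> 'D_((0, v) : R * (R * R)) rt (0, p) = 'D_v r p.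
  move=> Up; rewrite -derive_slice_right; apply: near_eq_derive.
  have : nbhs p U by exact: open_nbhs_nbhs.
  by apply: filterS => q /start[].
have start_s v (p : R * R) :
    U p -> 'D_((0, v) : R * (R * R)) st (0, p) = 'D_v s p.
  move=> Up; rewrite -derive_slice_right; apply: near_eq_derive.
  have : nbhs p U by exact: open_nbhs_nbhs.
  by apply: filterS => q /start[].
have sym (g : R * (R * R) -> R) (v w q : R * (R * R)) : smooth_on W g -> W q ->
    'D_w ('D_v g) q = 'D_v ('D_w g) q.
  by move=> sg Wq; exact: smooth_on_derive_comm sg Wq.
(* off K the variation does not depend on t *)
have phi0 p : U p -> ~ K p -> phi p = 0 /\ psi p = 0.
  move=> Up Kp; have near0 : \forall t \near (0 : R), `|t| < eta.
    exact: nbhs0_lt.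
  have := is_derive_slice_left (derW rt dt _ smrt (W0 p Up)).
  have := is_derive_slice_left (derW st dt _ smst (W0 p Up)).
  move=> [_ Es] [_ Er]; rewrite /phi /psi -Er -Es; split.
    rewrite (@near_eq_derive _ _ _ _ (cst (r p))) ?derive_cst //.
    by apply: filterS near0 => t te; have [] := supp t p te Up Kp.
  rewrite (@near_eq_derive _ _ _ _ (cst (s p))) ?derive_cst //.
  by apply: filterS near0 => t te; have [] := supp t p te Up Kp.
have Dphi (v p : R * R) : U p ->
    is_derive p v phi ('D_((0, v) : R * (R * R)) ('D_dt rt) (0, p)).
  move=> Up; apply: (@is_derive_slice_right R _ _ ('D_dt rt) 0).
  by apply: derW; [exact: smW|exact: W0].
have Dpsi (v p : R * R) : U p ->
    is_derive p v psi ('D_((0, v) : R * (R * R)) ('D_dt st) (0, p)).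
  move=> Up; apply: (@is_derive_slice_right R _ _ ('D_dt st) 0).
  by apply: derW; [exact: smW|exact: W0].
pose phix p := 'D_dx ('D_dt rt) (0, p); pose phiy p := 'D_dy ('D_dt rt) (0, p).
pose psix p := 'D_dx ('D_dt st) (0, p); pose psiy p := 'D_dy ('D_dt st) (0, p).
pose rxx := partial_x rx; pose ryy := partial_y ry.
pose sxx := partial_x sx; pose syy := partial_y sy.
pose P p := flux 2 (2 * d) (A (r p)) (B (r p)) (rx p) (sx p) (phi p) (psi p).
pose Q p := flux (- (2 * e)) (- (2 * d * e))
  (A (r p)) (B (r p)) (ry p) (sy p) (phi p) (psi p).
pose Px p := flux_derivative 2 (2 * d)
  (A (r p)) (B (r p)) (rx p) (sx p) (phi p) (psi p)
  (A' (r p) * rx p) (B' (r p) * rx p) (rxx p) (sxx p) (phix p) (psix p).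
pose Qy p := flux_derivative (- (2 * e)) (- (2 * d * e))
  (A (r p)) (B (r p)) (ry p) (sy p) (phi p) (psi p)
  (A' (r p) * ry p) (B' (r p) * ry p) (ryy p) (syy p) (phiy p) (psiy p).
have cont0 (g : R * (R * R) -> R) p :
    smooth_on W g -> U p -> {for p, continuous (fun p => g (0, p))}.
  by move=> sg Up; apply: continuous_slice_right; apply: contW => //; exact: W0.
have smD (g : R * R -> R) v : smooth_on U g -> smooth_on U ('D_v g).
  exact: smooth_on_derive.
have contU (g : R * R -> R) p :
    smooth_on U g -> U p -> {for p, continuous g}.
  exact: smooth_on_continuous.
have smrx : smooth_on U rx by exact: smD.
have smry : smooth_on U ry by exact: smD.
have smsx : smooth_on U sx by exact: smD.
have smsy : smooth_on U sy by exact: smD.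
have cAB p : U p -> [/\ {for p, continuous (fun p => A (r p))},
    {for p, continuous (fun p => A' (r p))},
    {for p, continuous (fun p => B (r p))} &
    {for p, continuous (fun p => B' (r p))}].
  move=> Up; have cr := contU r p smr Up; have Jrp := Jr p Up.
  split; [exact: (cont_comp (CA _ Jrp) cr)|exact: (cont_comp (dA _ Jrp).2 cr)
    |exact: (cont_comp (CB _ Jrp) cr)|exact: (cont_comp (dB _ Jrp).2 cr)].
have dAB (v p : R * R) : U p ->
    is_derive p v (fun p => A (r p)) (A' (r p) * 'D_v r p) /\
    is_derive p v (fun p => B (r p)) (B' (r p) * 'D_v r p).
  move=> Up; have dr := smooth_on_is_derive v smr Up; have Jrp := Jr p Up.
  by split; [exact: (is_derive_comp_dir dr (dA _ Jrp).1)
    |exact: (is_derive_comp_dir dr (dB _ Jrp).1)].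
have cphi p : U p -> [/\ {for p, continuous phi}, {for p, continuous psi} &
    [/\ {for p, continuous phix}, {for p, continuous phiy},
        {for p, continuous psix} & {for p, continuous psiy}]].
  have s1 := smW _ dt smrt; have s2 := smW _ dt smst => Up; split; [..|split].
  - exact: (cont0 ('D_dt rt)).
  - exact: (cont0 ('D_dt st)).
  - exact: (cont0 ('D_dx ('D_dt rt)) p (smW _ _ s1)).
  - exact: (cont0 ('D_dy ('D_dt rt)) p (smW _ _ s1)).
  - exact: (cont0 ('D_dx ('D_dt st)) p (smW _ _ s2)).
  - exact: (cont0 ('D_dy ('D_dt st)) p (smW _ _ s2)).
have crs p : U p -> [/\ {for p, continuous rx}, {for p, continuous ry},
    {for p, continuous sx} & {for p, continuous sy}].
  by move=> Up; split; exact: contU.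
have crrs p : U p -> [/\ {for p, continuous rxx}, {for p, continuous ryy},
    {for p, continuous sxx} & {for p, continuous syy}].
  move=> Up; split;
    [exact: (contU _ p (smD rx _ smrx))|exact: (contU _ p (smD ry _ smry))
    |exact: (contU _ p (smD sx _ smsx))|exact: (contU _ p (smD sy _ smsy))].
have dP p : U p ->
    is_derive p ((1, 0) : R * R) P (Px p) /\ {for p, continuous Px}.
  move=> Up; have [cA1 cA2 cB1 cB2] := cAB p Up.
  have [c1 c2 [c3 c4 c5 c6]] := cphi p Up.
  have [c7 c8 c9 c10] := crs p Up; have [c11 c12 c13 c14] := crrs p Up.
  split.
    apply: is_derive_flux; [exact: (dAB _ p Up).1|exact: (dAB _ p Up).2|..].
    - exact: (smooth_on_is_derive _ smrx Up).
    - exact: (smooth_on_is_derive _ smsx Up).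
    - exact: Dphi.
    - exact: Dpsi.
  exact: (cont_flux_derivative cA1 cB1 c7 c9 c1 c2
    (cont_mul cA2 c7) (cont_mul cB2 c7) c11 c13 c3 c5).
have dQ p : U p ->
    is_derive p ((0, 1) : R * R) Q (Qy p) /\ {for p, continuous Qy}.
  move=> Up; have [cA1 cA2 cB1 cB2] := cAB p Up.
  have [c1 c2 [c3 c4 c5 c6]] := cphi p Up.
  have [c7 c8 c9 c10] := crs p Up; have [c11 c12 c13 c14] := crrs p Up.
  split.
    apply: is_derive_flux; [exact: (dAB _ p Up).1|exact: (dAB _ p Up).2|..].
    - exact: (smooth_on_is_derive _ smry Up).
    - exact: (smooth_on_is_derive _ smsy Up).
    - exact: Dphi.
    - exact: Dpsi.
  exact: (cont_flux_derivative cA1 cB1 c8 c10 c1 c2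
    (cont_mul cA2 c8) (cont_mul cB2 c8) c12 c14 c4 c6).
have divergence (p : R * R) : U p -> ft (0, p) = Px p + Qy p.
  move=> Up; have Wp := W0 p Up.
  have Er : rt (0, p) = r p by have [] := start p Up.
  have Erx : 'D_dx rt (0, p) = rx p by exact: start_r.
  have Ery : 'D_dy rt (0, p) = ry p by exact: start_r.
  have Esx : 'D_dx st (0, p) = sx p by exact: start_s.
  have Esy : 'D_dy st (0, p) = sy p by exact: start_s.
  have Fr : 'D_dt rt (0, p) = phi p by [].
  (* Schwarz: t-derivatives of space derivatives of the variation are space
     derivatives of phi and psi *)
  have Frx : 'D_dt ('D_dx rt) (0, p) = phix p by exact: sym.
  have Fry : 'D_dt ('D_dy rt) (0, p) = phiy p by exact: sym.
  have Fsx : 'D_dt ('D_dx st) (0, p) = psix p by exact: sym.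
  have Fsy : 'D_dt ('D_dy st) (0, p) = psiy p by exact: sym.
  have congr := lagrangian_variation_congr A A' B B' e d
    Er Erx Ery Esx Esy Fr Frx Fry Fsx Fsy.
  apply: (etrans congr); apply: lagrangian_variation_flux.
    exact: EL1.
  exact: EL2.
have P0 p : U p -> ~ K p -> P p = 0.
  by move=> Up Kp; rewrite /P /flux; have [-> ->] := phi0 p Up Kp;
    rewrite !mulr0 subr0.
have Q0 p : U p -> ~ K p -> Q p = 0.
  by move=> Up Kp; rewrite /Q /flux; have [-> ->] := phi0 p Up Kp;
    rewrite !mulr0 subr0.
have IP : Rintegral (lebesgue2 R) K Px = 0.
  exact: (integral_partial_eq0 (or_introl erefl) cK oU KU dP P0).
have IQ : Rintegral (lebesgue2 R) K Qy = 0.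
  exact: (integral_partial_eq0 (or_intror erefl) cK oU KU dQ Q0).
have intP : (lebesgue2 R).-integrable K (EFin \o Px).
  by apply: (continuous_plane_integrable cK oU KU) => p /dP[].
have intQ : (lebesgue2 R).-integrable K (EFin \o Qy).
  by apply: (continuous_plane_integrable cK oU KU) => p /dQ[].
have mK := compact_plane_measurable cK.
transitivity (Rintegral (lebesgue2 R) K (fun p => Px p + Qy p)).
  by apply: eq_Rintegral => p; rewrite inE => /KU Up; exact: divergence.
apply: (etrans (RintegralD mK intP intQ)).
exact: (etrans (congr2 +%R IP IQ) (addr0 0)).
Qed.

(** * Hyperbolic functions *)

Lemma cosh_gt0 (R : realType) (x : R) : 0 < cosh x.
Proof. by rewrite divr_gt0 // addr_gt0 // expR_gt0. Qed.

Lemma cosh_sqr (R : realType) (x : R) : cosh x ^+ 2 = sinh x ^+ 2 + 1.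
Proof.
have E : expR x * expR (- x) = 1 by rewrite -expRD subrr expR0.
by rewrite -E /cosh /sinh; field.
Qed.

Lemma is_derive_expRN (R : realType) (x : R) :
  is_derive x 1 (fun y : R => expR (- y)) (- expR (- x)).
Proof.
have := is_derive_comp_dir (is_deriveNid x 1) (is_derive_expR (- x)).
by rewrite mulrN1.
Qed.

Lemma is_derive_sinh (R : realType) (x : R) : is_derive x 1 (@sinh R) (cosh x).
Proof.
have := is_derive_expRN x => dN.
rewrite /sinh; apply: is_derive_eq.
by rewrite /cosh /GRing.scale /=; field.
Qed.

Lemma is_derive_cosh (R : realType) (x : R) : is_derive x 1 (@cosh R) (sinh x).
Proof.
have := is_derive_expRN x => dN.
rewrite /cosh; apply: is_derive_eq.
by rewrite /sinh /GRing.scale /=; field.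
Qed.

Lemma is_derive_tanh (R : realType) (x : R) :
  is_derive x 1 (@tanh R) (1 - tanh x ^+ 2).
Proof.
have c0 : cosh x != 0 by rewrite gt_eqF // cosh_gt0.
have ds := is_derive_sinh x; have dc := is_derive_cosh x.
have dcV := is_deriveV c0 dc.
have H : is_derive x 1 (fun y => sinh y * (cosh y)^-1)
    (sinh x *: (- cosh x ^- 2 *: sinh x) + (cosh x)^-1 *: cosh x).
  exact: is_deriveM.
apply: (is_derive_eq H); rewrite /GRing.scale /= /tanh mulVf //.
by field.
Qed.

Lemma tanh_continuous (R : realType) : continuous (@tanh R).
Proof.
move=> x; have [dx _] := is_derive_tanh x.
exact/differentiable_continuous/derivable1_diffP.
Qed.

Definition arsinh' {R : realType} (x : R) : R := (Num.sqrt (x ^+ 2 + 1))^-1.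

Lemma sqr_add1_gt0 (R : realType) (x : R) : 0 < x ^+ 2 + 1.
Proof. by rewrite ltr_wpDl // sqr_ge0. Qed.

Lemma arsinh'_sqr (R : realType) (x : R) : arsinh' x ^+ 2 * (x ^+ 2 + 1) = 1.
Proof.
by rewrite exprVn sqr_sqrtr ?mulVf ?gt_eqF // ?ltW // sqr_add1_gt0.
Qed.

Lemma cosh_arsinh (R : realType) (x : R) :
  cosh (arsinh x) = Num.sqrt (x ^+ 2 + 1).
Proof.
by rewrite -[LHS]gtr0_norm ?cosh_gt0 // -sqrtr_sqr cosh_sqr arsinhK.
Qed.

Lemma tanh_arsinh (R : realType) (x : R) : tanh (arsinh x) = x * arsinh' x.
Proof. by rewrite /tanh arsinhK cosh_arsinh. Qed.

Lemma is_derive_sqrt_sqr_add1 (R : realType) (x : R) :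
  is_derive x 1 (fun y : R => Num.sqrt (y ^+ 2 + 1)) (x * arsinh' x).
Proof.
have dsq : is_derive x 1 (fun y : R => y ^+ 2 + 1) (2 * x).
  by apply: is_derive_eq; rewrite /GRing.scale /=; ring.
apply: is_derive_eq.
  exact: (is_derive_comp_dir dsq (is_derive1_sqrt (sqr_add1_gt0 x))).
by rewrite invfM /arsinh' mulrACA mulVf ?mul1r ?pnatr_eq0 // mulrC.
Qed.

Lemma is_derive_arsinh' (R : realType) (x : R) :
  is_derive x 1 (@arsinh' R) (- (x * arsinh' x ^+ 3)).
Proof.
have s0 : Num.sqrt (x ^+ 2 + 1) != 0.
  by rewrite gt_eqF // sqrtr_gt0 sqr_add1_gt0.
have ds := is_derive_sqrt_sqr_add1 x.
have H : is_derive x 1 (@arsinh' R)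
    (- Num.sqrt (x ^+ 2 + 1) ^- 2 *: (x * arsinh' x)).
  exact: (@is_deriveV _ (fun y => Num.sqrt (y ^+ 2 + 1))).
apply: (is_derive_eq H).
by rewrite /GRing.scale /= -exprVn -/(arsinh' x); ring.
Qed.

Lemma is_derive_arsinh (R : realType) (x : R) :
  is_derive x 1 (@arsinh R) (arsinh' x).
Proof.
set s := Num.sqrt (x ^+ 2 + 1).
have s0 : 0 < s by rewrite sqrtr_gt0 sqr_add1_gt0.
have pos : 0 < x + s.
  have : `|x| < s.
    by rewrite -sqrtr_sqr ltr_sqrt ?ltrDl // sqr_add1_gt0.
  by rewrite ltr_norml => /andP[+ _]; rewrite -subr_gt0 opprK addrC.
have ds := is_derive_sqrt_sqr_add1 x.
have dsum : is_derive x 1 (fun y : R => y + Num.sqrt (y ^+ 2 + 1))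
    (1 + x * arsinh' x).
  by apply: is_derive_eq.
apply: is_derive_eq; first exact: (is_derive_comp_dir dsum (is_derive1_ln pos)).
rewrite -/s /arsinh' -/s.
by field; rewrite !gt_eqF.
Qed.

(** * Smoothness of the map *)

Lemma class_C_sub (R : realType) (V : normedModType R) (k : nat) (U W : set V)
    (f : V -> R) :
  W `<=` U -> class_C k U f -> class_C k W f.
Proof.
move=> WU; elim: k f => [|k IH] f [cf df]; split => //.
- by move=> p /WU /cf.
- by move=> p /WU /cf.
- move=> v; have [dv Dv] := df v; split; last exact: IH.
  by move=> p /WU /dv.
Qed.

Lemma class_CS (R : realType) (V : normedModType R) (k : nat) (U : set V)
    (f : V -> R) :
  class_C k.+1 U f -> class_C k U f.
Proof.
elim: k f => [|k IH] f [cf df]; split => // v.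
by have [dv Dv] := df v; split => //; exact: IH.
Qed.

(** On the whole space the derivatives are known as functions and not only on an
    open set, so that membership in C^k is proved by induction through explicit
    formulas. *)
Lemma class_C_of_derive (R : realType) (V : normedModType R) (k : nat)
    (f : V -> R) (f' : V -> V -> R) :
  continuous f -> (forall v p, is_derive p v f (f' v p)) ->
  (forall v, class_C k setT (f' v)) -> class_C k.+1 setT f.
Proof.
move=> cf df Cf'; split; first by move=> p _; exact: cf.
move=> v; split; first by move=> p _; case: (df v p).
rewrite (_ : 'D_v f = f' v); first exact: Cf'.
by apply/funext => p; case: (df v p).
Qed.

Lemma class_C_derive (R : realType) (V : normedModType R) (k : nat)
    (f : V -> R) :
  class_C k.+1 setT f -> forall v p, is_derive p v f ('D_v f p).
Proof.
by move=> [_ df] v p; apply: derivableP; have [dv _] := df v; exact: dv.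
Qed.

Lemma class_C_cst (R : realType) (V : normedModType R) (k : nat) (c : R) :
  class_C k setT (fun _ : V => c).
Proof.
elim: k c => [|k IH] c; first by split => // p _; exact: cst_continuous.
apply: (class_C_of_derive (f' := fun _ _ => 0)).
- exact: cst_continuous.
- by move=> v; exact: IH.
Qed.

Lemma class_C_add (R : realType) (V : normedModType R) (k : nat)
    (f g : V -> R) :
  class_C k setT f -> class_C k setT g ->
  class_C k setT (fun p => (f p + g p : R)).
Proof.
elim: k f g => [|k IH] f g Cf Cg.
  by split => // p _; apply: cont_add; [exact: Cf.1|exact: Cg.1].
apply: (class_C_of_derive (f' := fun v p => 'D_v f p + 'D_v g p)).
- by move=> p; apply: cont_add; [exact: Cf.1|exact: Cg.1].
- move=> v p; have := class_C_derive Cf v p; have := class_C_derive Cg v p.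
  by move=> dg df; exact: is_deriveD.
- by move=> v; apply: IH; [exact: (Cf.2 v).2|exact: (Cg.2 v).2].
Qed.

Lemma class_C_mul (R : realType) (V : normedModType R) (k : nat)
    (f g : V -> R) :
  class_C k setT f -> class_C k setT g ->
  class_C k setT (fun p => (f p * g p : R)).
Proof.
elim: k f g => [|k IH] f g Cf Cg.
  by split => // p _; apply: cont_mul; [exact: Cf.1|exact: Cg.1].
apply: (class_C_of_derive (f' := fun v p => f p * 'D_v g p + g p * 'D_v f p)).
- by move=> p; apply: cont_mul; [exact: Cf.1|exact: Cg.1].
- move=> v p; have := class_C_derive Cf v p; have := class_C_derive Cg v p.
  by move=> dg df; exact: is_deriveM.
- by move=> v; apply: class_C_add; apply: IH;
    [exact: class_CS|exact: (Cg.2 v).2|exact: class_CS|exact: (Cf.2 v).2].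
Qed.

Definition linear_form {R : realType} (a b : R) (p : R * R) : R :=
  a * p.1 + b * p.2.

Lemma linear_form_continuous (R : realType) (a b : R) :
  continuous (linear_form a b).
Proof.
move=> p.
have c1 : {for p, continuous (fun q : R * R => q.1)} by exact: cvg_fst.
have c2 : {for p, continuous (fun q : R * R => q.2)} by exact: cvg_snd.
exact: (cont_add (cont_mul (cont_cst a p) c1) (cont_mul (cont_cst b p) c2)).
Qed.

Lemma is_derive_linear_form (R : realType) (a b : R) (p v : R * R) :
  is_derive p v (linear_form a b) (linear_form a b v).
Proof.
apply/is_derive_line.
rewrite (_ : (fun h : R => _) =
    (fun h : R => h * linear_form a b v + linear_form a b p)).
  by apply: is_derive_eq; rewrite /GRing.scale /=; ring.
by apply/funext => h; rewrite /linear_form /= /GRing.scale /=; ring.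
Qed.

Lemma class_C_linear_form (R : realType) (a b : R) (k : nat) :
  class_C k setT (linear_form a b).
Proof.
case: k => [|k]; first by split => // p _; exact: linear_form_continuous.
apply: (class_C_of_derive (f' := fun v _ => linear_form a b v)).
- exact: linear_form_continuous.
- by move=> v p; exact: is_derive_linear_form.
- by move=> v; exact: class_C_cst.
Qed.

Lemma comp_linear_form_continuous (R : realType) (a b : R) (f f' : R -> R) :
  (forall x : R, is_derive x 1 f (f' x)) ->
  continuous (fun p => f (linear_form a b p)).
Proof.
move=> df p; apply: cont_comp; last exact: linear_form_continuous.
have [dx _] := df (linear_form a b p).
exact/differentiable_continuous/derivable1_diffP.
Qed.

(** As arsinh'' = - x arsinh'^3, the first derivatives of arsinh' (z) are
    polynomials in z and arsinh' (z); C^k is closed under products, which gives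
    the induction step. *)
Lemma class_C_arsinh' (R : realType) (a b : R) (k : nat) :
  class_C k setT (fun p => arsinh' (linear_form a b p)).
Proof.
have cont := @comp_linear_form_continuous R a b _ _ (@is_derive_arsinh' R).
elim: k => [|k IH]; first by split => // p _; exact: cont.
apply: (class_C_of_derive (f' := fun v p =>
  (-1) * (linear_form a b p * (arsinh' (linear_form a b p) *
     (arsinh' (linear_form a b p) * arsinh' (linear_form a b p))))
  * linear_form a b v)) => //.
  move=> v p; apply: is_derive_eq.
    exact: (is_derive_comp_dir (is_derive_linear_form a b p v)
      (is_derive_arsinh' _)).
  by rewrite mulN1r.
move=> v; apply: class_C_mul; last exact: class_C_cst.
apply: class_C_mul; first exact: class_C_cst.
apply: class_C_mul; first exact: class_C_linear_form.
by apply: class_C_mul => //; exact: class_C_mul.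
Qed.

Lemma is_derive_arsinh_linear (R : realType) (a b : R) (p v : R * R) :
  is_derive p v (fun p => arsinh (linear_form a b p))
    (arsinh' (linear_form a b p) * linear_form a b v).
Proof.
exact: (is_derive_comp_dir (is_derive_linear_form a b p v)
  (is_derive_arsinh _)).
Qed.

Lemma smooth_arsinh_linear (R : realType) (a b : R) (U : set (R * R)) :
  smooth_on U (fun p => arsinh (linear_form a b p)).
Proof.
move=> k; apply: (@class_C_sub _ _ _ setT) => //; apply: class_CS.
apply: class_C_of_derive; last first.
- by move=> v; exact: (class_C_mul (class_C_arsinh' a b k)
    (class_C_cst _ k (linear_form a b v))).
- by move=> v p; exact: is_derive_arsinh_linear.
- exact: comp_linear_form_continuous (@is_derive_arsinh R).
Qed.

Lemma smooth_linear_form (R : realType) (a b : R) (U : set (R * R)) :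
  smooth_on U (linear_form a b).
Proof.
by move=> k; apply: (@class_C_sub _ _ _ setT) => //; exact: class_C_linear_form.
Qed.

(** * The explicit wave maps *)

(** With z = a x + b y and g = arsinh' z, the Euler-Lagrange equations of
    (arsinh z, m x + n y) factor: the one for r is - 2 z g^3 times the first
    scalar equation, and the one for s is 2 z g^4 times the second. *)
Lemma arsinh_linear_wave_map (R : realType) (eps delta : R[i]) (a b m n : R)
    (U : set (R * R)) :
  let e := re_sqr eps in let d := re_sqr delta in
  open U -> (forall p, U p -> arsinh (linear_form a b p) <> 0) ->
  a ^+ 2 - e * b ^+ 2 = d * (m ^+ 2 - e * n ^+ 2) ->
  a * m = e * (b * n) ->
  wave_map eps delta (fun _ => 1) (fun rho => tanh rho ^+ 2)
    U [set rho | rho <> 0]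
    (fun p => arsinh (linear_form a b p)) (linear_form m n).
Proof.
move=> e d oU U0 H1 H2.
pose r := fun p : R * R => arsinh (linear_form a b p).
pose z := linear_form a b; pose g p := arsinh' (z p).
have rpE (v p : R * R) : 'D_v r p = g p * linear_form a b v.
  by case: (is_derive_arsinh_linear a b p v).
have spE (v p : R * R) : 'D_v (linear_form m n) p = linear_form m n v.
  by case: (is_derive_linear_form m n p v).
have rE (v : R * R) : 'D_v r = fun p => g p * linear_form a b v.
  by apply/funext => p; exact: rpE.
have sE (v : R * R) : 'D_v (linear_form m n) = fun _ => linear_form m n v.
  by apply/funext => p; exact: spE.
have rrE (v p : R * R) : 'D_v ('D_v r) p =
    - (z p * g p ^+ 3) * linear_form a b v * linear_form a b v.
  rewrite rE.
  have dg : is_derive p v g (- (z p * g p ^+ 3) * linear_form a b v) :=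
    is_derive_comp_dir (is_derive_linear_form a b p v)
    (is_derive_arsinh' (linear_form a b p)).
  have [_ ->] : is_derive p v (fun p => g p * linear_form a b v)
      (linear_form a b v *: (- (z p * g p ^+ 3) * linear_form a b v)).
    apply: is_derive_eq.
    by rewrite /GRing.scale /=; ring.
  by rewrite /GRing.scale /=; ring.
have ssE (v p : R * R) : 'D_v ('D_v (linear_form m n)) p = 0.
  by rewrite sE; exact: derive_cst.
have lx (c c' : R) : linear_form c c' (1, 0) = c.
  by rewrite /linear_form /= mulr1 mulr0 addr0.
have ly (c c' : R) : linear_form c c' (0, 1) = c'.
  by rewrite /linear_form /= mulr1 mulr0 add0r.
have gz p : g p ^+ 2 * (z p ^+ 2 + 1) = 1 by exact: arsinh'_sqr.
apply: (wave_map_of_euler_lagrange (A' := fun _ => 0)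
  (B' := fun rho => 2 * tanh rho * (1 - tanh rho ^+ 2))) => //.
- exact: smooth_arsinh_linear.
- exact: smooth_linear_form.
- by move=> x _; split; [exact: is_derive_cst|exact: cst_continuous].
- move=> x _; split.
    have dx := is_derive_tanh x; apply: is_derive_eq.
    by rewrite /GRing.scale /=; ring.
  have ct : {for x, continuous (fun y => tanh y)} by exact: tanh_continuous.
  exact: (cont_mul (cont_mul (cont_cst 2 x) ct)
    (cont_add (cont_cst 1 x) (cont_opp (cont_sqr ct)))).
- move=> p _; rewrite /partial_x /partial_y -/r !rrE !rpE !spE !lx !ly.
  rewrite /r tanh_arsinh -/(z p) -/(g p) -/e -/d.
  have -> : 1 - (z p * g p) ^+ 2 = g p ^+ 2 by rewrite -(gz p); ring.
  rewrite mul0r addr0.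
  rewrite (_ : _ + _ = - 2 * z p * g p ^+ 3 *
    ((a ^+ 2 - e * b ^+ 2) - d * (m ^+ 2 - e * n ^+ 2))); last by ring.
  by rewrite H1 subrr mulr0.
- move=> p _; rewrite /partial_x /partial_y -/r !ssE !rpE !spE !lx !ly -/e.
  set B := tanh _ ^+ 2; set B' := 2 * _ * _.
  rewrite (_ : _ + _ = B' * g p * (a * m - e * (b * n))); last by ring.
  by rewrite H2 subrr mulr0.
Qed.

Unset Implicit Arguments.

Theorem proposition11 (R : realType) (eps delta : R[i]) (theta : R)
    (M : set (R * R))
    (heps : eps = 1 \/ eps = 'i) (hdelta : delta = 1 \/ delta = 'i)
    (hneq : delta <> eps)
    (htheta0 : 0 < theta) (htheta1 : theta < pi / 4)
    (hM : open M) :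
  wave_map eps delta (fun _ => 1) (fun rho => tanh rho ^+ 2)
    [set p | M p /\ mapR eps theta p <> 0] [set rho | rho <> 0]
    (mapR eps theta) (mapS eps theta).
Proof.
pose e := re_sqr eps; pose d := re_sqr delta.
have eE : e = 1 \/ e = -1.
  by rewrite /e; case: heps => ->; rewrite ?re_sqr1 ?re_sqri; [left|right].
have dE : d = - e.
  rewrite /d /e; case: heps hneq => ->; case: hdelta => -> // _;
    by rewrite ?re_sqr1 ?re_sqri ?opprK.
pose c := cos theta; pose s := sin theta.
have cs1 : c ^+ 2 + s ^+ 2 = 1 by exact: cos2Dsin2.
have cs0 : c ^+ 2 - s ^+ 2 != 0.
  have <- : cos (theta + theta) = c ^+ 2 - s ^+ 2 by rewrite cosD -!expr2.
  have pi0 := pi_gt0 R.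
  by rewrite gt_eqF //; apply: cos_gt0_pihalf; apply/andP; split; lra.
pose D := c ^+ 2 - e * s ^+ 2.
pose k := (1 + e) * c * s / (s ^+ 2 - e * c ^+ 2).
have RE : mapR eps theta = fun p => arsinh (linear_form (- s / D) (c / D) p).
  apply/funext => p; congr arsinh.
  by rewrite /linear_form -/c -/s -/e -/D; ring.
have SE : mapS eps theta = linear_form (c - k * s) (s + k * c).
  by apply/funext => p; rewrite /mapS /linear_form -/c -/s -/e -/k; ring.
have grad : [/\ D != 0, c - k * s = c / D & s + k * c = - e * s / D].
  rewrite /k /D; case: eE => ->; last first.
    (* e = - 1: the coefficient k is 0 and D is 1 *)
    rewrite mulN1r opprK cs1 subrr !mul0r !addr0 subr0 !divr1 opprK mul1r.
    by rewrite oner_neq0.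
  rewrite !mul1r -(opprB (c ^+ 2)); set q := c ^+ 2 - s ^+ 2 in cs0 *.
  have cE : c * q + 2 * c * s ^+ 2 = c * (c ^+ 2 + s ^+ 2) by rewrite /q; ring.
  have sE : s * q - 2 * c ^+ 2 * s = - s * (c ^+ 2 + s ^+ 2).
    by rewrite /q; ring.
  rewrite cs1 mulr1 in cE; rewrite cs1 mulr1 in sE.
  split => //.
    by rewrite -[c in RHS]cE; field.
  by rewrite -[RHS]/(- 1 * s / q) mulN1r -[- s]sE; field.
have [D0 mE nE] := grad.
have cont : continuous (fun p => arsinh (linear_form (- s / D) (c / D) p)).
  exact: comp_linear_form_continuous (@is_derive_arsinh R).
rewrite RE SE mE nE; apply: arsinh_linear_wave_map; rewrite -/e -/d ?dE.
- rewrite openE => p [Mp rp]; apply: filterI; first exact: open_nbhs_nbhs.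
  have : \forall q \near p, arsinh (linear_form (- s / D) (c / D) q) != 0.
    by apply: (cvgr_neq0 _ (cont p)); apply/eqP.
  by apply: filterS => q /eqP.
- by move=> p [].
- by clearbody D; case: eE => ->; field.
- by clearbody D; case: eE => ->; field.
Qed.
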